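(* Let $k$ be a field, $n\ge 1$ and $A\in M_n(k)$. Suppose $$xI-A=\gamma_1\operatorname{diag}(f_1,\ldots,f_n)\,\gamma_2$$ is a Smith Normal Form decomposition of $xI-A\in M_n(k[x])$; that is, $\gamma_1,\gamma_2\in GL_n(k[x])$, $f_1,\dots,f_n\in k[x]$ with $f_1\mid f_2\mid\cdots\mid f_n$, and every nonzero $f_i$ is monic. Let $y_1,\ldots,y_n\in k[x]^n$ be the columns of $\gamma_1$, so $\gamma_1=[y_1,\ldots,y_n]$. Let $m$ be the largest integer such that $\deg f_{m-1}=0$ (with $m=1$ if no $f_i$ has degree $0$). Then $f_m,\ldots,f_n$ are the invariant factors of $A$. Moreover, let $\lambda_i=\deg f_i$ for $m\le i\le n$, let $\phi:k[x]^n\to k^n$ be defined by $\phi\big(\sum_{i\ge0}x^iv_i\big)=\sum_{i\ge 0}A^iv_i$ (with $v_i\in k^n$, only finitely many nonzero), and let $P$ be the matrix $$P=\big[\,\phi(y_m)\mid A\phi(y_m)\mid\cdots\mid A^{\lambda_m-1}\phi(y_m)\mid\phi(y_{m+1})\mid\cdots\mid A^{\lambda_{m+1}-1}\phi(y_{m+1})\mid\cdots\mid\phi(y_n)\mid\cdots\mid A^{\lambda_n-1}\phi(y_n)\,\big].$$ Then $P$ is an invertible $n\times n$ matrix over $k$ and $$A=P\,\big(C(f_m)\oplus\cdots\oplus C(f_n)\big)\,P^{-1}.$$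
   Context: For $A\in M_n(k)$, $V_A$ denotes the $k[x]$-module $k^n$ with $x\cdot v=Av$. The invariant factors of $A$ are the unique nonconstant monic polynomials $g_1\mid g_2\mid\cdots\mid g_r$ in $k[x]$ such that $V_A\cong k[x]/g_1k[x]\oplus\cdots\oplus k[x]/g_rk[x]$ as $k[x]$-modules. For a monic polynomial $f(x)=x^d+c_{d-1}x^{d-1}+\cdots+c_0\in k[x]$ with $d\ge1$, the companion matrix $C(f)\in M_d(k)$ is the matrix whose $s$-th column is the standard basis vector $e_{s+1}$ for $1\le s\le d-1$ and whose last column is $(-c_0,-c_1,\ldots,-c_{d-1})^{T}$. For square matrices, $\oplus$ denotes the block diagonal sum. Elements of $k[x]^n$ are column vectors and are written uniquely as finite sums $\sum_i x^iv_i$ with $v_i\in k^n$. *)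

(* Defs.v *)
From HB Require Import structures.
From mathcomp Require Import all_boot all_order all_algebra.
From mathcomp Require Import qpoly.

Set Implicit Arguments.
Unset Strict Implicit.
Unset Printing Implicit Defensive.
Set Warnings "-redundant-canonical-projection".

Import GRing.Theory.
Local Open Scope ring_scope.

(* V_A : the k[x]-module carried by k^n, where x acts as A. *)
Section MatrixModule.
Variables (k : fieldType) (n : nat).

Definition matrix_module (A : 'M[k]_n.+1) : Type := 'cV[k]_n.+1.

Variable A : 'M[k]_n.+1.

HB.instance Definition _ := GRing.Zmodule.copy (matrix_module A) 'cV[k]_n.+1.

Definition matrix_module_scale (p : {poly k}) (v : matrix_module A) :
  matrix_module A := horner_mx A p *m v.

Fact matrix_module_scaleA p q v :
  matrix_module_scale p (matrix_module_scale q v) =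
  matrix_module_scale (p * q) v.
Proof. by rewrite /matrix_module_scale mulmxA rmorphM. Qed.

Fact matrix_module_scale1 : left_id 1 matrix_module_scale.
Proof. by move=> v; rewrite /matrix_module_scale rmorph1 mul1mx. Qed.

Fact matrix_module_scaleDr : right_distributive matrix_module_scale +%R.
Proof. by move=> p u v; exact: mulmxDr. Qed.

Fact matrix_module_scaleDl v :
  {morph matrix_module_scale^~ v : p q / p + q}.
Proof. by move=> p q; rewrite /matrix_module_scale rmorphD; exact: mulmxDl. Qed.

HB.instance Definition _ :=
  GRing.Zmodule_isLmodule.Build {poly k} (matrix_module A)
    matrix_module_scaleA matrix_module_scale1
    matrix_module_scaleDr matrix_module_scaleDl.

Lemma matrix_module_scaleX (v : matrix_module A) : 'X *: v = A *m v.
Proof. by rewrite /GRing.scale /= /matrix_module_scale horner_mx_X. Qed.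

End MatrixModule.

(* k[x]/gk[x] as a k[x]-module.  The alias keeps this structure apart from   *)
(* the k-module structure that {poly %/ g} already carries.  Note that        *)
(* {poly %/ g} is k[x]/gk[x] only when g is monic and nonconstant.            *)
Section QuotientModule.
Variable k : fieldType.

Definition quotient_module (g : {poly k}) : Type := {poly %/ g}.

Variable g : {poly k}.

HB.instance Definition _ := GRing.Zmodule.copy (quotient_module g) {poly %/ g}.

Definition quotient_module_scale (p : {poly k}) (u : quotient_module g) :
  quotient_module g := (in_qpoly g p : {poly %/ g}) * (u : {poly %/ g}).

Fact quotient_module_scaleA p q u :
  quotient_module_scale p (quotient_module_scale q u) =
  quotient_module_scale (p * q) u.
Proof. by rewrite /quotient_module_scale mulrA rmorphM. Qed.

Fact quotient_module_scale1 : left_id 1 quotient_module_scale.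
Proof. by move=> u; rewrite /quotient_module_scale rmorph1 mul1r. Qed.

Fact quotient_module_scaleDr : right_distributive quotient_module_scale +%R.
Proof. by move=> p u v; exact: mulrDr. Qed.

Fact quotient_module_scaleDl u :
  {morph quotient_module_scale^~ u : p q / p + q}.
Proof. by move=> p q; rewrite /quotient_module_scale rmorphD; exact: mulrDl. Qed.

HB.instance Definition _ :=
  GRing.Zmodule_isLmodule.Build {poly k} (quotient_module g)
    quotient_module_scaleA quotient_module_scale1
    quotient_module_scaleDr quotient_module_scaleDl.

Lemma in_qpoly_eq0 (p : {poly k}) :
  g \is monic -> (1 < size g)%N -> (in_qpoly g p == 0) = (g %| p).
Proof.
move=> g_monic g_gt1; rewrite -val_eqE /= /mk_monic g_gt1 g_monic /=.
by rewrite -Pdiv.IdomainMonic.modpE.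
Qed.

End QuotientModule.

(* The library has function modules only for a constant codomain, hence this  *)
(* dependent version.                                                         *)
Section DirectSum.
Variables (R : nzRingType) (r : nat).

Definition direct_sum (M : 'I_r -> lmodType R) : Type :=
  {dffun forall i, M i}.

Variable M : 'I_r -> lmodType R.

HB.instance Definition _ := Choice.copy (direct_sum M) {dffun forall i, M i}.

Implicit Types u v w : direct_sum M.

Definition direct_sum_zero : direct_sum M := [ffun i => 0 : M i].
Definition direct_sum_opp u : direct_sum M := [ffun i => - u i].
Definition direct_sum_add u v : direct_sum M := [ffun i => u i + v i].
Definition direct_sum_scale (a : R) u : direct_sum M := [ffun i => a *: u i].

Fact direct_sum_addA : associative direct_sum_add.
Proof. by move=> u v w; apply/ffunP=> i; rewrite !ffunE addrA. Qed.
Fact direct_sum_addC : commutative direct_sum_add.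
Proof. by move=> u v; apply/ffunP=> i; rewrite !ffunE addrC. Qed.
Fact direct_sum_add0 : left_id direct_sum_zero direct_sum_add.
Proof. by move=> u; apply/ffunP=> i; rewrite !ffunE add0r. Qed.
Fact direct_sum_addN : left_inverse direct_sum_zero direct_sum_opp direct_sum_add.
Proof. by move=> u; apply/ffunP=> i; rewrite !ffunE addNr. Qed.

HB.instance Definition _ := GRing.isZmodule.Build (direct_sum M)
  direct_sum_addA direct_sum_addC direct_sum_add0 direct_sum_addN.

Fact direct_sum_scaleA a b u :
  direct_sum_scale a (direct_sum_scale b u) = direct_sum_scale (a * b) u.
Proof. by apply/ffunP=> i; rewrite !ffunE scalerA. Qed.
Fact direct_sum_scale1 : left_id 1 direct_sum_scale.
Proof. by move=> u; apply/ffunP=> i; rewrite !ffunE scale1r. Qed.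
Fact direct_sum_scaleDr : right_distributive direct_sum_scale +%R.
Proof. by move=> a u v; apply/ffunP=> i; rewrite !ffunE scalerDr. Qed.
Fact direct_sum_scaleDl u : {morph direct_sum_scale^~ u : a b / a + b}.
Proof. by move=> a b; apply/ffunP=> i; rewrite !ffunE scalerDl. Qed.

HB.instance Definition _ := GRing.Zmodule_isLmodule.Build R (direct_sum M)
  direct_sum_scaleA direct_sum_scale1 direct_sum_scaleDr direct_sum_scaleDl.

End DirectSum.

Definition lmod_isomorphic (R : nzRingType) (U V : lmodType R) : Prop :=
  exists F : {linear U -> V}, bijective F.

Definition are_invariant_factors (k : fieldType) (n : nat) (A : 'M[k]_n.+1)
    (r : nat) (g : 'I_r -> {poly k}) : Prop :=
  [/\ forall i, g i \is monic /\ (1 < size (g i))%N,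
      forall i j : 'I_r, (i <= j)%N -> g i %| g j
    & lmod_isomorphic (matrix_module A)
        (direct_sum (fun i => quotient_module (g i)))].

(* The library's companionmx carries the coefficients in its last row. *)
Definition companion (k : fieldType) (f : {poly k}) : 'M[k]_((size f).-1) :=
  (companionmx f)^T.

Lemma companionE (k : fieldType) (f : {poly k}) i j :
  companion f i j =
    if j == (size f).-2 :> nat then - f`_i else (i == j.+1 :> nat)%:R.
Proof. by rewrite !mxE [j.+1 == _]eq_sym. Qed.

Section Phi.
Variables (k : fieldType) (n : nat) (A : 'M[k]_n.+1).

(* map_mx (coefp i) y is the coefficient v_i in y = \sum_i 'X^i v_i. *)
Definition phi (y : 'cV[{poly k}]_n.+1) : 'cV[k]_n.+1 :=
  \sum_(i < \max_j size (y j 0%R)) A ^+ i *m map_mx (coefp i) y.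

Lemma phi_widen N (y : 'cV[{poly k}]_n.+1) : (forall j, (size (y j 0%R) <= N)%N) ->
  phi y = \sum_(i < N) A ^+ i *m map_mx (coefp i) y.
Proof.
move=> szy; have leN : (\max_j size (y j 0%R) <= N)%N by apply/bigmax_leqP.
rewrite /phi (big_ord_widen N (fun i => A ^+ i *m map_mx (coefp i) y)) //.
rewrite big_mkcond /=; apply: eq_bigr => i _; case: ltnP => // le_i.
suff -> : map_mx (coefp i) y = 0 by rewrite mulmx0.
apply/matrixP => j s; rewrite !mxE ord1 /= /coefp nth_default //.
by apply: leq_trans le_i; exact: (leq_bigmax j).
Qed.

Lemma phi_sum d (v : nat -> 'cV[k]_n.+1) :
  phi (\sum_(i < d) 'X^i *: map_mx polyC (v i)) =
  \sum_(i < d) A ^+ i *m v i.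
Proof.
set y := (X in phi X).
have yE j : y j 0 = \poly_(i < d) v i j 0.
  rewrite poly_def /y summxE; apply: eq_bigr => i _.
  by rewrite !mxE mulrC mul_polyC.
rewrite (@phi_widen d) => [|j]; last by rewrite yE size_poly.
apply: eq_bigr => i _; congr (_ *m _).
by apply/matrixP => j s; rewrite !mxE ord1 /= /coefp yE coef_poly ltn_ord.
Qed.

End Phi.

Section Indices.
Variables (k : fieldType) (n : nat) (f : 'I_n -> {poly k}).

(* The largest m such that f_(m-1) has degree 0 (size 1), for indices starting *)
(* from 0, with m = 0 if there is no such f_i: the 1-based m is one more.      *)
Definition first_index : nat := \max_(i < n | size (f i) == 1%N) i.+1.

Lemma tail_ord_proof m (j : 'I_(n - m)) : (m + j < n)%N.
Proof. by rewrite -ltn_subRL. Qed.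

Definition tail_ord m (j : 'I_(n - m)) : 'I_n := Ordinal (tail_ord_proof j).
End Indices.

(* Main.v *)
Require Import Defs.
From HB Require Import structures.
From mathcomp Require Import all_boot all_order all_algebra.
From mathcomp Require Import qpoly.

Set Implicit Arguments.
Unset Strict Implicit.
Unset Printing Implicit Defensive.

Import GRing.Theory.
Local Open Scope ring_scope.

(* The map phi : k[x]^n -> V_A is k[x]-linear and surjective and kills the    *)
(* columns of xI - A.  Since (xI - A) gamma2^-1 = gamma1 diag(f_i), it kills   *)
(* f_i y_i, and since the y_i form a basis of k[x]^n, the vectors phi(y_i)     *)
(* generate V_A; those with f_i = 1 vanish.  Taking determinants in the Smith  *)
(* form gives \sum_i deg f_i = n, so the n spanning vectors A^s phi(y_i) with  *)
(* s < deg f_i form a basis, without any computation of the kernel of phi.     *)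
(* In that basis A is the block sum of companion matrices, and                 *)
(* (p_i) |-> \sum_i p_i(A) phi(y_i) is the isomorphism from the direct sum of  *)
(* the k[x]/f_i k[x] to V_A.                                                   *)

(** Linearity of [phi] is [phi_mulmx] and [phi_scale], surjectivity is [phi_const], the relations
    come from [phi_char_mx]. The linear algebra is isolated in [cyclic_decomposition_mx] and
    [cyclic_decomposition_lmod]: vectors that generate the module, are killed by the [g j], and
    whose degrees add up to the dimension force a direct sum, since a spanning family of the right
    length is a basis. *)

Lemma horner_mx_widen (k : fieldType) n (A : 'M[k]_n.+1) N (p : {poly k}) :
  (size p <= N)%N -> horner_mx A p = \sum_(i < N) p`_i *: A ^+ i.
Proof.
move=> szp; rewrite -[LHS](congr1 (horner_mx A) (coefK p)) poly_def.
rewrite (big_ord_widen N (fun i => p`_i *: 'X^i)) // big_mkcond /= raddf_sum.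
apply: eq_bigr => i _; case: ltnP => [_|lei].
  by rewrite /= horner_mxZ rmorphXn /= horner_mx_X.
by rewrite raddf0 nth_default ?scale0r.
Qed.

(** * The map [phi] as a [k[x]]-linear surjection *)

Section Phi.
Variables (k : fieldType) (n : nat) (A : 'M[k]_n.+1).

(** Grouping by coordinates rather than by powers of [x] reduces linearity over [k[x]] to
    [horner_mx A] being a ring morphism. *)
Lemma phiE (y : 'cV[{poly k}]_n.+1) :
  phi A y = \sum_j horner_mx A (y j 0) *m delta_mx j 0.
Proof.
have szy j : (size (y j 0%R) <= \max_j size (y j 0%R))%N by exact: (leq_bigmax j).
rewrite (phi_widen A szy).
under [RHS]eq_bigr => j _ do rewrite (horner_mx_widen A (szy j)) mulmx_suml.
rewrite exchange_big /=; apply: eq_bigr => i _.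
rewrite [X in _ *m X]matrix_sum_delta mulmx_sumr; apply: eq_bigr => j _.
by rewrite big_ord1 mxE /= -scalemxAr -scalemxAl.
Qed.

Lemma phi_mulmx m (B : 'M[{poly k}]_(n.+1, m)) (u : 'cV[{poly k}]_m) :
  phi A (B *m u) = \sum_l horner_mx A (u l 0) *m phi A (col l B).
Proof.
rewrite phiE.
under eq_bigr => j _ do rewrite mxE raddf_sum mulmx_suml.
rewrite exchange_big; apply: eq_bigr => l _.
rewrite phiE mulmx_sumr; apply: eq_bigr => j _.
by rewrite /= mxE mulrC rmorphM /= mulmxA.
Qed.

Lemma phi_scale p (y : 'cV[{poly k}]_n.+1) :
  phi A (p *: y) = horner_mx A p *m phi A y.
Proof.
rewrite !phiE mulmx_sumr; apply: eq_bigr => j _.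
by rewrite mxE rmorphM /= mulmxA.
Qed.

Lemma phi_const (v : 'cV[k]_n.+1) : phi A (map_mx polyC v) = v.
Proof.
rewrite phiE [RHS]matrix_sum_delta; apply: eq_bigr => j _.
by rewrite big_ord1 mxE /= horner_mx_C mul_scalar_mx.
Qed.

Lemma phi_char_mx (u : 'cV[{poly k}]_n.+1) :
  phi A (('X%:M - map_mx polyC A) *m u) = 0.
Proof.
rewrite phi_mulmx big1 // => l _.
suff -> : phi A (col l ('X%:M - map_mx polyC A)) = 0 by rewrite mulmx0.
rewrite phiE; under eq_bigr => j _.
  rewrite !mxE rmorphB rmorphMn /= horner_mx_X horner_mx_C mulmxBl mul_scalar_mx.
  over.
(* Column [l] is [x e_l - A e_l]; its two parts both map to [A e_l]. *)
rewrite big_split /= sumrN (bigD1 l) //= eqxx big1 ?addr0 => [|j /negPf->].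
  apply/eqP; rewrite subr_eq0 -colE; apply/eqP/matrixP=> i s.
  rewrite ord1 summxE (bigD1 i) //= big1 => [|j jni]; rewrite !mxE.
    by rewrite !eqxx mulr1 addr0.
  by rewrite eq_sym (negPf jni) mulr0.
by rewrite mulr0n mul0mx.
Qed.

End Phi.

(** * Matrices that are square only up to a propositional equality of sizes *)

Section CastUnit.
Variables (R : comUnitRingType) (m s : nat) (e : s = m) (P : 'M[R]_(m, s)).

Lemma mul_castmx (D : 'M[R]_s) :
  castmx (erefl m, e) P *m castmx (e, e) D = castmx (erefl m, e) (P *m D).
Proof. by case: m / e P => P'; rewrite !castmx_id. Qed.

Lemma mulmx_castr p (B : 'M[R]_(p, m)) :
  B *m castmx (erefl m, e) P = castmx (erefl p, e) (B *m P).
Proof. by case: m / e P B => P' B; rewrite !castmx_id. Qed.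

Lemma mulmx1C_eq (C : 'M[R]_(s, m)) : P *m C = 1%:M -> C *m P = 1%:M.
Proof. by case: m / e P C => P' C; exact: mulmx1C. Qed.

Lemma castmx_unit (C : 'M[R]_(s, m)) :
  P *m C = 1%:M -> castmx (erefl m, e) P \in unitmx.
Proof. by case: m / e P C => P' C /mulmx1_unit[]; rewrite castmx_id. Qed.

End CastUnit.

(** * Krylov matrices and companion blocks *)

Section Krylov.
Variables (k : fieldType) (n : nat) (A : 'M[k]_n.+1).

Definition krylov d (v : 'cV[k]_n.+1) : 'M[k]_(n.+1, d) :=
  \matrix_(i < n.+1, s < d) (A ^+ s *m v) i 0.

Lemma krylov_mul d (v : 'cV[k]_n.+1) (p : {poly k}) : (size p <= d)%N ->
  horner_mx A p *m v = krylov d v *m (poly_rV p)^T.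
Proof.
move=> szp; rewrite (horner_mx_widen A szp) mulmx_suml.
apply/matrixP=> i j; rewrite ord1 summxE mxE; apply: eq_bigr => s _.
by rewrite -scalemxAl !mxE mulrC.
Qed.

(** [A] shifts each Krylov column to the next; on the last one, the relation [g(A) v = 0] with [g]
    monic expresses the top power through the lower ones. *)
Lemma mul_krylov_companion (g : {poly k}) (v : 'cV[k]_n.+1) :
  g \is monic -> horner_mx A g *m v = 0 ->
  A *m krylov (size g).-1 v = krylov (size g).-1 v *m companion g.
Proof.
move=> g_mon gv0; apply/matrixP=> i j.
have d_gt0 : (0 < (size g).-1)%N by case: (size g).-1 j => [[]|].
have szg : size g = (size g).-1.+1.
  by rewrite prednK // (leq_trans d_gt0) ?leq_pred.
transitivity ((A ^+ j.+1 *m v) i 0).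
  rewrite exprS -mulmxE -mulmxA !mxE; apply: eq_bigr => l _.
  by rewrite mxE.
rewrite [RHS]mxE; under eq_bigr => s _ do rewrite companionE mxE.
case: (altP (j =P (size g).-2 :> nat)) => [jlast|jn].
  have -> : j.+1 = (size g).-1 by rewrite jlast prednK.
  move/eqP: gv0; rewrite (horner_mx_widen A (leqnn _)) szg big_ord_recr /=.
  rewrite -/(lead_coef g) (monicP g_mon) scale1r mulmxDl addrC addr_eq0.
  move=> /eqP ->; rewrite mxE mulmx_suml summxE -sumrN; apply: eq_bigr => s _.
  by rewrite -scalemxAl mxE mulrN mulrC.
have ltj : (j.+1 < (size g).-1)%N.
  rewrite ltn_neqAle ltn_ord andbT.
  by apply: contra jn => /eqP/(congr1 predn)/= ->.
rewrite (bigD1 (Ordinal ltj)) //= eqxx mulr1 big1 ?addr0 // => s.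
by rewrite -val_eqE /= => /negPf ->; rewrite mulr0.
Qed.

End Krylov.

Lemma val_in_qpoly (k : fieldType) (g p : {poly k}) :
  g \is monic -> (1 < size g)%N -> val (in_qpoly g p) = p %% g.
Proof.
move=> g_mon g_gt1; rewrite /= /mk_monic g_gt1 g_mon /=.
by rewrite -Pdiv.IdomainMonic.modpE.
Qed.

(** Allows linearity to be checked on the map out of the direct sum, opposite to the required
    isomorphism. *)
Lemma can2_lmod_isomorphic (R : nzRingType) (U V : lmodType R)
    (F : U -> V) (G : V -> U) :
  linear G -> cancel F G -> cancel G F -> lmod_isomorphic U V.
Proof.
move=> linG FK GK.
have linF : linear F by move=> a x y; apply: (canLR GK); rewrite linG !FK.
pose lin := GRing.isLinear.Build R U V _ F linF.
pose F' : {linear U -> V} := HB.pack F lin.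
by exists F'; exists G.
Qed.

(** * Decomposition from cyclic generators and a dimension count *)

Section CyclicDecomposition.
Variables (k : fieldType) (n : nat) (A : 'M[k]_n.+1) (r : nat).
Variables (g : 'I_r -> {poly k}) (v : 'I_r -> 'cV[k]_n.+1).
Hypothesis g_mon : forall j, g j \is monic.
Hypothesis g_gt1 : forall j, (1 < size (g j))%N.
Hypothesis gv0 : forall j, horner_mx A (g j) *m v j = 0.
Hypothesis v_span :
  forall u, exists w : 'I_r -> {poly k}, u = \sum_j horner_mx A (w j) *m v j.
Hypothesis size_g : (\sum_j (size (g j)).-1)%N = n.+1.

Let P : 'M[k]_(n.+1, \sum_j (size (g j)).-1) :=
  \mxrow_j krylov A (size (g j)).-1 (v j).

Let predn_size_g j : (size (g j)).-1.+1 = size (g j).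
Proof. by rewrite prednK // (leq_trans _ (g_gt1 j)). Qed.

Lemma horner_mx_modp j p :
  horner_mx A (p %% g j) *m v j = horner_mx A p *m v j.
Proof.
rewrite {2}(divp_eq p (g j)) rmorphD rmorphM /=.
by rewrite mulmxDl -mulmxE -mulmxA gv0 mulmx0 add0r.
Qed.

Lemma krylov_mxrow_mul (w : 'I_r -> {poly k}) :
  (forall j, size (w j) <= (size (g j)).-1)%N ->
  \sum_j horner_mx A (w j) *m v j =
  P *m \mxcol_j (poly_rV (w j) : 'rV_(size (g j)).-1)^T.
Proof.
move=> szw; rewrite mul_mxrow_mxcol; apply: eq_bigr => j _.
exact: krylov_mul.
Qed.

(** Reducing coefficients modulo [g j] makes them fit the available columns, so the columns of [P]
    span. Only a right inverse arises here; [size_g] later makes it two-sided. *)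
Lemma krylov_mxrow_inv : exists C, P *m C = 1%:M.
Proof.
have /fin_all_exists[c Pc] :
    forall i : 'I_n.+1, exists c : 'cV_(_), P *m c = delta_mx i 0.
  move=> i; have [w ->] := v_span (delta_mx i 0).
  exists (\mxcol_j (poly_rV (w j %% g j) : 'rV_(size (g j)).-1)^T).
  rewrite -krylov_mxrow_mul => [|j].
    by under eq_bigr do rewrite horner_mx_modp.
  by rewrite -ltnS predn_size_g ltn_modp monic_neq0.
exists (\matrix_(s, i) c i s 0); apply/matrixP=> a i.
have /matrixP/(_ a 0) := Pc i; rewrite !mxE eqxx andbT => <-.
by apply: eq_bigr => s _; rewrite !mxE.
Qed.

Lemma cyclic_decomposition_mx :
  let Q := castmx (erefl n.+1, size_g) P in
  Q \in unitmx /\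
  A = Q *m castmx (size_g, size_g) (\mxdiag_j companion (g j)) *m invmx Q.
Proof.
move=> Q; have [C PC] := krylov_mxrow_inv.
have Qunit : Q \in unitmx by exact: castmx_unit PC.
split=> //; apply: (canRL (mulmxK Qunit)); rewrite mul_castmx.
rewrite mulmx_castr.
congr castmx; rewrite mul_mxrow mul_mxrow_mxdiag.
by apply: eq_mxrow => j; exact: mul_krylov_companion.
Qed.

Lemma cyclic_decomposition_lmod :
  lmod_isomorphic (matrix_module A)
    (direct_sum (fun j => quotient_module (g j))).
Proof.
pose rep (u : direct_sum (fun j => quotient_module (g j))) j : {poly k} :=
  val (u j : {poly %/ g j}).
pose F u : 'cV[k]_n.+1 := \sum_j horner_mx A (rep u j) *m v j.
have mk_gE j : mk_monic (g j) = g j by rewrite /mk_monic g_gt1 g_mon.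
have szrep u j : (size (rep u j) <= (size (g j)).-1)%N.
  rewrite -ltnS predn_size_g.
  by apply: leq_trans (size_mk_monic (u j : {poly %/ g j})) _; rewrite mk_gE.
have repZ p u j : rep (p *: u) j = (p * rep u j) %% g j.
  rewrite -val_in_qpoly // /rep !ffunE rmorphM.
  apply: (congr1 (fun z : {poly %/ g j} => val (in_qpoly (g j) p * z))).
  by apply: val_inj; apply/esym/in_qpoly_small/size_mk_monic.
have repD u w j : rep (u + w) j = rep u j + rep w j by rewrite /rep !ffunE.
have linF : linear (F : _ -> matrix_module A).
  move=> p u w; suff : F (p *: u + w) = horner_mx A p *m F u + F w by [].
  rewrite /F mulmx_sumr -big_split.
  apply: eq_bigr => j _ /=.
  by rewrite repD rmorphD mulmxDl repZ horner_mx_modp rmorphM /= -mulmxE mulmxA.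
have [C PC] := krylov_mxrow_inv; have CP := mulmx1C_eq size_g PC.
(* [C *m x] holds the coordinates of [x] in the columns of [P]; block [j] lists the coefficients of
   the [j]-th representative. *)
pose G (x : matrix_module A) : direct_sum (fun j => quotient_module (g j)) :=
  [ffun j => in_qpoly (g j) (rVpoly (submxcol (C *m x) j)^T)].
have FE u : F u = P *m \mxcol_j (poly_rV (rep u j) : 'rV_(size (g j)).-1)^T.
  exact: krylov_mxrow_mul.
apply: (can2_lmod_isomorphic linF (F := G)) => [x | u]; last first.
  apply/ffunP=> j; rewrite ffunE; apply: val_inj => /=.
  rewrite FE mulmxA CP mul1mx mxcolK trmxK poly_rV_K //.
  exact: in_qpoly_small (size_mk_monic _).
rewrite FE -[RHS]mul1mx -PC -[RHS]mulmxA; congr (_ *m _).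
apply/mxcolP=> j; rewrite mxcolK /rep ffunE [val _]in_qpoly_small.
  by rewrite rVpolyK trmxK.
by rewrite mk_gE (leq_ltn_trans (size_poly _ _)) // predn_size_g.
Qed.

End CyclicDecomposition.

(** Serves twice to drop the indices with [f i = 1]: in the sum of degrees and in the spanning
    family. *)
Lemma big_tail_ord (R : Type) (idx : R) (op : Monoid.com_law idx) n m
    (F : 'I_n -> R) :
  (forall i : 'I_n, (i < m)%N -> F i = idx) ->
  \big[op/idx]_i F i = \big[op/idx]_(j < n - m) F (tail_ord j).
Proof.
move=> F0; rewrite (bigID (fun i : 'I_n => (i < m)%N)) /= big1 ?Monoid.mul1m //.
rewrite (reindex_omap (@tail_ord n m) (fun i => insub (i - m)%N)) => [|i]; last first.
  rewrite -leqNgt => lemi; case: insubP => [j _ jE|] /=.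
    by congr Some; apply: val_inj; rewrite /= jE subnKC.
  by rewrite ltn_sub2r // (leq_ltn_trans lemi).
apply: eq_bigl => j; rewrite /= -leqNgt leq_addr /= addKn.
by rewrite insubT //= => ltj; apply/eqP; congr Some; apply: val_inj.
Qed.

Theorem theorem4p3 (k : fieldType) (n : nat) (A : 'M[k]_n.+1)
    (gamma1 gamma2 : 'M[{poly k}]_n.+1) (f : 'I_n.+1 -> {poly k})
    (hgamma1 : gamma1 \in unitmx) (hgamma2 : gamma2 \in unitmx)
    (hdvd : forall i j : 'I_n.+1, (i <= j)%N -> f i %| f j)
    (hmonic : forall i, f i != 0 -> f i \is monic)
    (hsnf : 'X%:M - map_mx polyC A =
            gamma1 *m diag_mx (\row_i f i) *m gamma2) :
  let m := first_index f in
  let g := fun j : 'I_(n.+1 - m) => f (tail_ord j) in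
  let y := fun j : 'I_(n.+1 - m) => col (tail_ord j) gamma1 in
  let lambda := fun j : 'I_(n.+1 - m) => (size (g j)).-1 in
  let P : 'M[k]_(n.+1, \sum_j lambda j) :=
    \mxrow_j \matrix_(i < n.+1, s < lambda j)
      (A ^+ s *m phi A (y j)) i 0 in
  are_invariant_factors A g /\
  exists e : (\sum_j lambda j)%N = n.+1,
    let Q := castmx (erefl n.+1, e) P in
    Q \in unitmx /\
    A = Q *m castmx (e, e) (\mxdiag_j companion (g j)) *m invmx Q.
Proof.
move=> m g y lambda P.
have charE : char_poly A = \det gamma1 * \prod_i f i * \det gamma2.
  rewrite /char_poly /char_poly_mx hsnf !det_mulmx det_diag.
  by under eq_bigr do rewrite mxE.
have unit_size1 (p : {poly k}) : p \is a GRing.unit -> size p = 1%N.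
  by rewrite poly_unitE => /andP[/eqP].
have f_neq0 i : f i != 0.
  have := monic_neq0 (char_poly_monic A); rewrite charE.
  rewrite !mulf_eq0 !negb_or => /andP[/andP[_ /prodf_neq0 nz] _]; exact: nz.
have f_mon i : f i \is monic by exact: hmonic.
(* An index below [m] has some constant [f j] at or after it, which [f i] divides. *)
have f_head (i : 'I_n.+1) : (i < m)%N -> f i = 1.
  rewrite /m /first_index => im; apply/eqP.
  rewrite -(eqp_monic (f_mon i) (monic1 _)).
  apply: contraLR im; rewrite -leqNgt => fi; apply/bigmax_leqP => j /eqP szj.
  rewrite leqNgt; apply: contra fi => ij.
  by rewrite -size_poly_eq1 -dvdp1; apply: (dvdp_trans (hdvd i j ij)); rewrite dvdp1 szj.
have f_tail (i : 'I_n.+1) : (m <= i)%N -> (1 < size (f i))%N.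
  move=> mi; rewrite ltn_neqAle size_poly_gt0 f_neq0 andbT eq_sym.
  apply: contraL mi => fi; rewrite -ltnNge.
  rewrite /m /first_index (bigD1 i fi).
  exact: leq_maxl.
have tail_ge (j : 'I_(n.+1 - m)) : (m <= tail_ord j)%N by exact: leq_addr.
have size_g : (\sum_j lambda j)%N = n.+1.
  have det1 B : B \in unitmx -> size (\det B : {poly k}) = 1%N.
    by move=> uB; exact: unit_size1.
  have det0 B : B \in unitmx -> (\det B : {poly k}) != 0.
    by move=> uB; rewrite -size_poly_gt0 det1.
  have := size_char_poly A; rewrite charE size_mul ?mulf_neq0 ?det0 //; last first.
    by apply/prodf_neq0.
  rewrite size_mul ?det0 //; last by apply/prodf_neq0.
  rewrite !det1 // addn1 add1n /= size_prod //.
  (* [size] exceeds the degree by one, which cancels the cardinal in [size_prod]. *)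
  have -> : (\sum_i size (f i) = \sum_i (size (f i)).-1 + #|'I_n.+1|)%N.
    rewrite -sum1_card -big_split; apply: eq_bigr => i _ /=.
    by rewrite addn1 prednK // size_poly_gt0.
  rewrite -addSn addnK => -[sum_f]; rewrite -[RHS]sum_f.
  apply/esym/big_tail_ord => i im; by rewrite f_head // size_poly1.
have phi_rel i : horner_mx A (f i) *m phi A (col i gamma1) = 0.
  rewrite -phi_scale -(phi_char_mx A (invmx gamma2 *m delta_mx i 0)) hsnf.
  rewrite mulmxA mulmxK // -colE.
  by congr phi; apply/matrixP=> a b; rewrite mul_mx_diag !mxE mulrC.
have phi_span u : exists w : 'I_(n.+1 - m) -> {poly k},
    u = \sum_j horner_mx A (w j) *m phi A (y j).
  (* The coordinates of the constant vector [u] in the basis of columns of [gamma1]. *)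
  pose w := invmx gamma1 *m map_mx polyC u.
  exists (fun j => w (tail_ord j) 0).
  rewrite -[LHS](phi_const A) -[map_mx _ _](mulKVmx hgamma1) phi_mulmx.
  apply: big_tail_ord => i im; have := phi_rel i.
  by rewrite f_head // rmorph1 mul1mx => ->; rewrite mulmx0.
have g_mon j : g j \is monic by exact: f_mon.
have g_gt1 j : (1 < size (g j))%N by exact: f_tail (tail_ge j).
have gy0 j : horner_mx A (g j) *m phi A (y j) = 0 by exact: phi_rel.
split; last first.
  by exists size_g; exact: (cyclic_decomposition_mx g_mon g_gt1 gy0 phi_span).
split=> [j|i j ij|]; first by split.
  by apply: hdvd; rewrite leq_add2l.
exact: cyclic_decomposition_lmod g_mon g_gt1 gy0 phi_span size_g.
Qed.
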